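(* Let $n\ge 6$, and let $k\ge1$, $l\ge 2$ be integers with $k+l+3=n$. Then $F(G_{3,4}^{(n)}) > F(R_{k,l})$.
   Context: All graphs are finite and simple. The F-index of a graph $G$ is $F(G)=\sum_{v\in V(G)} d_G(v)^3$. Attaching a leaf to a vertex means adding a new vertex adjacent only to it. $G_{3,4}^{(n)}$ is obtained from a triangle $xyz$ by attaching $n-5$ leaves to $x$, one leaf to $y$ and one leaf to $z$. For $k,l\ge 1$, $R_{k,l}$ is obtained from a triangle $xyz$ by attaching $k$ pendant vertices to $z$ and then attaching $l$ new leaves to one of these pendant vertices; it has $k+l+3$ vertices. *)

(* Defs.v *)
From mathcomp Require Import all_boot.

Set Implicit Arguments.
Unset Strict Implicit.
Unset Printing Implicit Defensive.

Record sgraph := SGraph {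
  vertex :> finType;
  adj : rel vertex;
  adj_sym : symmetric adj;
  adj_irrefl : irreflexive adj
}.

Definition deg (G : sgraph) (v : G) : nat := #|[set u : G | adj v u]|.

Definition F_index (G : sgraph) : nat := \sum_(v : G) deg v ^ 3.

Section AttachLeaves.
Variables (G : sgraph) (v : G) (m : nat).

(* [inl u] is the vertex u of G; [inr j] is the j-th of the m new leaves. *)
Definition attach_adj (a b : (G + 'I_m)%type) : bool :=
  match a, b with
  | inl u, inl w => adj u w
  | inl u, inr _ => u == v
  | inr _, inl w => w == v
  | inr _, inr _ => false
  end.

Lemma attach_adj_sym : symmetric attach_adj.
Proof. by move=> [a|a] [b|b] //=; exact: adj_sym. Qed.

Lemma attach_adj_irrefl : irreflexive attach_adj.
Proof. by move=> [a|a] //=; exact: adj_irrefl. Qed.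

Definition attach_leaves : sgraph := SGraph attach_adj_sym attach_adj_irrefl.

End AttachLeaves.

Definition triangle_adj : rel 'I_3 := fun i j => i != j.

Lemma triangle_adj_sym : symmetric triangle_adj.
Proof. by move=> i j; rewrite /triangle_adj eq_sym. Qed.

Lemma triangle_adj_irrefl : irreflexive triangle_adj.
Proof. by move=> i; rewrite /triangle_adj eqxx. Qed.

Definition triangle : sgraph := SGraph triangle_adj_sym triangle_adj_irrefl.

Definition tri_x : triangle := @Ordinal 3 0 isT.
Definition tri_y : triangle := @Ordinal 3 1 isT.
Definition tri_z : triangle := @Ordinal 3 2 isT.

(* Intended for n >= 5, where the subtraction is not truncated. *)
Definition G34 (n : nat) : sgraph :=
  let Gx := attach_leaves tri_x (n - 5) in
  let Gxy := @attach_leaves Gx (inl tri_y) 1 in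
  @attach_leaves Gxy (inl (inl tri_z)) 1.

(* R_{k,l}: the index i selects which of the k pendant vertices at z receives
   the l new leaves; different choices of i give isomorphic graphs. *)
Definition R (k l : nat) (i : 'I_k) : sgraph :=
  @attach_leaves (attach_leaves tri_z k) (inr i) l.

Arguments R : clear implicits.

(* Main.v *)
(* If v has degree d, attaching m leaves to v adds (d + m)^3 - d^3 + m to F.
   Starting from F(triangle) = 24 and putting k = p + 1, l = q + 2, both indices
   become explicit polynomials in p and q, and
     F(G_{3,4}) - F(R_{k,l}) = 12 + 18 p q + 3 p q (p + q) > 0. *)
Require Import Defs.
From mathcomp Require Import all_boot zify.

Lemma deg_attach_inl (G : sgraph) (v : G) (m : nat) (u : G) :
  @deg (attach_leaves v m) (inl u) = deg u + (u == v) * m.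
Proof.
rewrite /deg -!sum1dep_card big_sumType /=; congr (_ + _).
by case: (u == v); [rewrite mul1n sum1_card card_ord | rewrite big_pred0_eq].
Qed.

Lemma deg_attach_inr (G : sgraph) (v : G) (m : nat) (j : 'I_m) :
  @deg (attach_leaves v m) (inr j) = 1.
Proof.
rewrite /deg -sum1dep_card big_sumType /= big_pred0_eq addn0.
by rewrite big_pred1_eq.
Qed.

(** Among the old vertices only [v] changes degree, and each leaf contributes 1. The old cube stands
    on the left to avoid truncated subtraction. *)
Lemma F_index_attach (G : sgraph) (v : G) (m : nat) :
  F_index (attach_leaves v m) + deg v ^ 3 = F_index G + (deg v + m) ^ 3 + m.
Proof.
rewrite /F_index big_sumType /=.
under [X in _ + X + _]eq_bigr => j _ do rewrite deg_attach_inr.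
rewrite sum_nat_const card_ord (bigD1 v) //= [in RHS](bigD1 v) //=.
rewrite deg_attach_inl eqxx mul1n.
under eq_bigr => u /negbTE uv do rewrite deg_attach_inl uv mul0n addn0.
lia.
Qed.

Lemma deg_triangle (u : triangle) : deg u = 2.
Proof.
rewrite /deg (_ : [set w | adj u w] = [set~ u]).
  by rewrite cardsC1 card_ord.
by apply/setP => w; rewrite !inE eq_sym.
Qed.

Lemma F_index_triangle : F_index triangle = 24.
Proof.
rewrite /F_index; under eq_bigr => u _ do rewrite deg_triangle.
by rewrite sum_nat_const card_ord.
Qed.

(** Each triangle vertex still has degree 2 when its own leaves arrive, so the constant is 24 - 8 +
    2 * (27 - 8 + 1) = 56. *)
Lemma F_index_G34 (n : nat) : F_index (G34 n) = (n - 5 + 2) ^ 3 + (n - 5) + 56.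
Proof.
have Fx := F_index_attach triangle tri_x (n - 5).
have Fy := F_index_attach (attach_leaves tri_x (n - 5)) (inl tri_y) 1.
have Fz := F_index_attach
  (@attach_leaves (attach_leaves tri_x (n - 5)) (inl tri_y) 1)
  (inl (inl tri_z)) 1.
rewrite !deg_attach_inl !deg_triangle F_index_triangle /= !mul0n !addn0 in Fx Fy Fz.
apply: (@addIn (2 ^ 3)); apply: etrans Fz _.
move: (F_index _) (F_index _) Fx Fy => f g.
rewrite (addnC _ 2); lia.
Qed.

(** The 1 on the left is the cubed degree of the pendant vertex before it receives leaves; 16 is 24
    - 2 ^ 3. *)
Lemma F_index_R (k l : nat) (i : 'I_k) :
  F_index (R k l i) + 1 = (k + 2) ^ 3 + (l + 1) ^ 3 + k + l + 16.
Proof.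
have Fz := F_index_attach triangle tri_z k.
have Fi := F_index_attach (attach_leaves tri_z k) (inr i) l.
rewrite deg_attach_inr !deg_triangle F_index_triangle in Fz Fi.
rewrite /R (addnC k 2) (addnC l 1); lia.
Qed.

Theorem theorem9 (n k l : nat) (hn : 6 <= n) (hk : 1 <= k) (hl : 2 <= l)
  (hkl : k + l + 3 = n) (i : 'I_k) :
  F_index (G34 n) > F_index (R k l i).
Proof.
have FR := F_index_R k l i; rewrite F_index_G34.
(* These shifts turn the cubed terms into [p + q + 3] against [p + 3] and [q + 3], so every
   nonconstant monomial not divisible by [p * q] cancels. *)
have [p kE] : exists p, k = p + 1 by exists (k - 1); lia.
have [q lE] : exists q, l = q + 2 by exists (l - 2); lia.
have -> : n - 5 = p + q + 1 by lia.
move: (F_index _) FR => f; rewrite kE lE; nia.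
Qed.
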